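(* Assume that $\mathcal{P}$ admits the UGC property with respect to $d$, i.e., for every $\delta>0$, $\lim_{n\to\infty}\sup_{\mathbb{P}\in\mathcal{P}}\mathbb{P}[d(\widehat m_n,\mathbb{P}_1)\ge\delta]=0$, and let $\mathbb{P}\in\mathcal{P}$. If the mapping $T:\mathcal{M}\to\mathbf{T}$ is continuous at $\mathbb{P}_1$ with respect to $(d,d_{\mathbf{T}})$, then the sequence $(\widehat T_n)$ is qualitatively $\mathcal{P}$-marginally robust at $\mathbb{P}$ with respect to $(d,d'_{\mathrm{Proh}})$; that is, for every $\varepsilon>0$ there are some $\delta>0$ and $n_0\in\mathbb{N}$ such that for every $\mathbb{Q}\in\mathcal{P}$ $$d(\mathbb{P}_1,\mathbb{Q}_1)\le\delta\quad\Longrightarrow\quad d'_{\mathrm{Proh}}\bigl(\mathbb{P}\circ\widehat T_n^{-1},\mathbb{Q}\circ\widehat T_n^{-1}\bigr)\le\varepsilon\quad\text{for all } n\ge n_0.$$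
   Context: Let $(E,\mathcal{E})$ be a measurable space, $\Omega:=E^{\mathbb{N}}$, $\mathcal{F}:=\mathcal{E}^{\mathbb{N}}$ the product $\sigma$-field, and $X_i$ the $i$th coordinate projection on $\Omega$. For a probability measure $\mathbb{P}$ on $(\Omega,\mathcal{F})$ let $\mathbb{P}_i:=\mathbb{P}\circ X_i^{-1}$ be its $i$th marginal distribution. Let $\mathcal{P}$ be a class of probability measures on $(\Omega,\mathcal{F})$ such that $\mathbb{P}_1=\mathbb{P}_2=\cdots$ for every $\mathbb{P}\in\mathcal{P}$ (no independence is assumed), and let $\mathcal{P}_1:=\{\mathbb{P}_1:\mathbb{P}\in\mathcal{P}\}$. For $x=(x_1,x_2,\ldots)\in\Omega$ and $n\in\mathbb{N}$ let $\widehat m_n(x):=\frac1n\sum_{i=1}^n\delta_{x_i}$ be the empirical probability measure. Let $\mathcal{M}$ be a set of probability measures on $(E,\mathcal{E})$ that contains $\mathcal{P}_1$ and all empirical probability measures $\widehat m_n(x)$, $x\in\Omega$, $n\in\mathbb{N}$. Let $d$ be a metric on $\mathcal{M}$ such that $x\mapsto d(\widehat m_n(x),\mathbb{P}_1)$ is $(\mathcal{F},\mathcal{B}(\mathbb{R}_+))$-measurable for all $n\in\mathbb{N}$ and $\mathbb{P}\in\mathcal{P}$. Let $\mathbf{T}$ be a set equipped with a complete and separable metric $d_{\mathbf{T}}$ and the corresponding Borel $\sigma$-field $\mathcal{T}$. Let $T:\mathcal{M}\to\mathbf{T}$ be a mapping, and set $\widehat T_n(x):=T(\widehat m_n(x))$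 for $x\in\Omega$; it is assumed that $\widehat T_n:\Omega\to\mathbf{T}$ is $(\mathcal{F},\mathcal{T})$-measurable for every $n\in\mathbb{N}$. The Prohorov metric on the set of probability measures on $(\mathbf{T},\mathcal{T})$ is $d'_{\mathrm{Proh}}(\mu,\nu):=\inf\{\varepsilon>0:\mu[A]\le\nu[A^\varepsilon]+\varepsilon\text{ for all }A\in\mathcal{T}\}$, where $A^\varepsilon:=\{t\in\mathbf{T}:\inf_{a\in A}d_{\mathbf{T}}(t,a)\le\varepsilon\}$. *)

(* Defs.v *)
From HB Require Import structures.
From mathcomp Require Import all_boot all_order all_algebra.
From mathcomp Require Import all_classical all_reals all_analysis.
From mathcomp Require Import giry.

Set Implicit Arguments.
Unset Strict Implicit.
Unset Printing Implicit Defensive.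

Import Order.TTheory GRing.Theory Num.Theory.
Import numFieldNormedType.Exports.

Local Open Scope classical_set_scope.
Local Open Scope ring_scope.

(* Conventions.
   - Indices start at 0: [coord i] is the (i+1)-st coordinate X_{i+1}, so that
     [marginal P 0] is P_1, and [empirical n] is the empirical measure of
     the first n+1 observations.
   - A [probability E R] is a function on all sets, whose values on
     non-measurable sets carry no information. Two of them represent the same
     probability measure iff they agree on measurable sets: [measure_eq]. *)

Definition cylinders d (E : measurableType d) : set (set (nat -> E)) :=
  \bigcup_i preimage_set_system setT (fun x : nat -> E => x i) measurable.

Definition Omega d (E : measurableType d) :
    measurableType (@cylinders d E).-sigma :=
  g_sigma_algebraType (@cylinders d E).

Section sequence_space.
Context d (E : measurableType d).

Definition coord (i : nat) (x : Omega E) : E := x i.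

Let measurable_coord i : measurable_fun [set: Omega E] (coord i).
Proof. by move=> _ B mB; apply: sub_sigma_algebra; exists i => //; exists B. Qed.

HB.instance Definition _ i :=
  isMeasurableFun.Build _ _ (Omega E) E (coord i) (measurable_coord i).

Definition marginal (R : realType) (P : probability (Omega E) R) (i : nat) :
  probability E R := distribution P (coord i).

Definition empirical_fun (R : realType) (n : nat) (x : Omega E) :
    set E -> \bar R :=
  mscale ((n.+1%:R : R)^-1)%:nng (msum (fun i => \d_(coord i x)) n.+1).

HB.instance Definition _ (R : realType) n x :=
  Measure.on (@empirical_fun R n x).

Let empirical_setT (R : realType) n x : @empirical_fun R n x setT = 1%E.
Proof.
rewrite /empirical_fun /mscale/= /msum/=.
under eq_bigr do rewrite diracT.
by rewrite sumEFin sumr_const card_ord -EFinM mulVf.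
Qed.

HB.instance Definition _ (R : realType) n x :=
  Measure_isProbability.Build _ _ _ (@empirical_fun R n x)
    (@empirical_setT R n x).

Definition empirical (R : realType) (n : nat) (x : Omega E) :
  probability E R := @empirical_fun R n x.

End sequence_space.

Section metrics_on_measures.
Context d (E : measurableType d) (R : realType).
Variables (M : set (probability E R)) (dM : probability E R -> probability E R -> R).

Definition metric_on : Prop :=
  [/\ forall mu nu, M mu -> M nu -> 0 <= dM mu nu,
      forall mu nu, M mu -> M nu -> (dM mu nu = 0 <-> measure_eq mu nu),
      forall mu nu, M mu -> M nu -> dM mu nu = dM nu mu &
      forall mu nu rho, M mu -> M nu -> M rho ->
        dM mu rho <= dM mu nu + dM nu rho].

(* The values of T outside M are irrelevant throughout. *)
Definition mapping_on (S : Type) (T : probability E R -> S) : Prop :=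
  forall mu nu, M mu -> M nu -> measure_eq mu nu -> T mu = T nu.

Definition continuous_on_at (S : metricType R) (T : probability E R -> S)
    (mu : probability E R) : Prop :=
  forall eps : R, 0 < eps -> exists2 delta : R, 0 < delta &
    forall nu, M nu -> dM nu mu < delta -> mdist (T nu) (T mu) < eps.

End metrics_on_measures.

#[short(type="completeMetricType")]
HB.structure Definition CompleteMetric (R : numDomainType) :=
  {S of Complete S & Metric R S}.

Definition separable (S : topologicalType) : Prop :=
  exists2 D : set S, countable D & dense D.

Definition borel (R : realType) (S : completeMetricType R) :
    measurableType (@open S).-sigma :=
  g_sigma_algebraType (@open S).

Section prohorov.
Context (R : realType) (S : completeMetricType R).

(* The infimum is taken in \bar R, so that the thickening of set0 is set0. *)
Definition thickening (eps : R) (A : set S) : set S :=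
  [set t | (ereal_inf [set (mdist t a)%:E | a in A] <= eps%:E)%E].

Definition prohorov (mu nu : probability (borel S) R) : R :=
  inf [set eps : R | 0 < eps /\ forall A : set (borel S), measurable A ->
    (mu A <= nu (thickening eps A) + eps%:E)%E].

End prohorov.

Section robustness.
Context d (E : measurableType d) (R : realType).
Variables (PP : set (probability (Omega E) R))
          (dM : probability E R -> probability E R -> R).

Definition UGC : Prop := forall delta : R, 0 < delta ->
  ereal_sup [set P [set x | delta <= dM (empirical R n x) (marginal P 0)]
            | P in PP] @[n --> \oo] --> 0%E.

Definition marginally_robust_at d' (S : measurableType d')
    (dL : probability S R -> probability S R -> R)
    (That : nat -> {mfun Omega E >-> S}) (P : probability (Omega E) R) : Prop :=
  forall eps : R, 0 < eps -> exists2 delta : R, 0 < delta &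
    exists n0 : nat, forall Q, PP Q ->
      dM (marginal P 0) (marginal Q 0) <= delta ->
      forall n, (n0 <= n)%N ->
        dL (distribution P (That n)) (distribution Q (That n)) <= eps.

End robustness.

(* Main.v *)
(* Both empirical laws put all but eps of their mass on one ball of diameter at
   most eps around T(P_1): by continuity of T at P_1 it suffices that the
   empirical measure is close to P_1, which UGC gives uniformly under P and,
   since Q_1 is close to P_1, also under Q. Two laws that are concentrated in
   this way are within Prohorov distance eps. *)
Require Import Defs.
From HB Require Import structures.
From mathcomp Require Import all_boot all_order all_algebra.
From mathcomp Require Import all_classical all_reals all_analysis.
From mathcomp Require Import giry.
Import Order.TTheory GRing.Theory Num.Theory.
Import numFieldNormedType.Exports.
Local Open Scope classical_set_scope.
Local Open Scope ring_scope.

Section prohorov_theory.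
Context (R : realType) (S : completeMetricType R).
Implicit Types (eps r : R) (A B : set S) (s t : S).

(** The infimum need not be attained, hence the slack [r]. For empty [A] both sides fail. *)
Lemma thickeningP eps A t :
  thickening eps A t <->
  forall r, 0 < r -> exists2 a, A a & mdist t a < eps + r.
Proof.
split=> [ht r r0|h].
  have /ereal_inf_lt[_ [a Aa <-]] :
      (ereal_inf [set (mdist t a)%:E | a in A] < (eps + r)%:E)%E.
    by apply: (le_lt_trans ht); rewrite lte_fin ltrDl.
  by rewrite lte_fin => ta; exists a.
apply/lee_addgt0Pr => r r0; have [a Aa ta] := h r r0.
apply: ge_ereal_inf; exists (mdist t a)%:E; first by exists a.
by rewrite -EFinD lee_fin ltW.
Qed.

Lemma thickening_set1 eps s t :
  thickening eps [set s] t <-> mdist t s <= eps.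
Proof. by rewrite /thickening /= image_set1 ereal_inf1 lee_fin. Qed.

(** Half of the slack [r] pays for moving from [t] to a nearby point of the thickening, the other
    half for reaching [A] from there. *)
Lemma closed_thickening eps A : closed (thickening eps A).
Proof.
move=> t clt; apply/thickeningP => r r0.
have r20 : 0 < r / 2 by rewrite divr_gt0.
have [s [/thickeningP/(_ _ r20)[a Aa sa] ts]] :=
  clt _ (nbhsx_ballx t _ r20).
exists a => //; move: ts; rewrite ballEmdist /= => ts.
apply: (le_lt_trans (metric_triangle t s a)).
by rewrite [r in eps + r]splitr addrCA ltrD.
Qed.

Lemma measurable_thickening eps A :
  measurable (thickening eps A : set (borel S)).
Proof.
rewrite -[X in measurable X]setCK; apply: measurableC.
by apply: sub_sigma_algebra; exact/closed_openC/closed_thickening.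
Qed.

(** If [A] meets [B], the diameter bound puts [B] inside the thickening of [A], whose [nu]-mass plus
    [eps] is then at least 1. Otherwise [A] lies in the complement of [B], which has [mu]-mass at
    most [eps]. *)
Lemma prohorov_le_concentrated (mu nu : probability (borel S) R) eps
    (B : set (borel S)) :
  0 < eps -> measurable B ->
  (forall s t, B s -> B t -> mdist s t <= eps) ->
  (mu (~` B) <= eps%:E)%E -> (nu (~` B) <= eps%:E)%E ->
  prohorov mu nu <= eps.
Proof.
(* All admissible radii are positive, so [0] is a lower bound and it suffices that [eps] is
   admissible. *)
move=> eps0 mB diamB muB nuB; apply: ge_inf; first by exists 0 => x [/ltW].
split=> // A mA; have mAe := measurable_thickening eps A.
have [[a [Aa Ba]]|A0] := pselect (A `&` B !=set0).
  have nuBA : (nu B <= nu (thickening eps A))%E.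
    rewrite le_measure ?inE// => t Bt.
    by apply: ge_ereal_inf; exists (mdist t a)%:E;
      [exists a | rewrite lee_fin diamB].
  apply: (le_trans (probability_le1 mu mA)).
  rewrite -(probability_setT nu) -(setUv B).
  apply: (le_trans (measureU2 nu mB (measurableC mB))).
  exact: leeD.
have AB : A `<=` ~` B by move=> t At Bt; apply: A0; exists t.
apply: (@le_trans _ _ (mu (~` B))).
  by rewrite le_measure ?inE//; exact: measurableC.
by apply: (le_trans muB); rewrite leeDr.
Qed.

End prohorov_theory.

(** The supremum over [PP] makes [n0] independent of [Q], as robustness requires. *)
Lemma UGC_uniform (R : realType) (disp : measure_display)
    (E : measurableType disp) (PP : set (probability (Omega E) R))
    (dM : probability E R -> probability E R -> R) (delta eps : R) :
  UGC PP dM -> 0 < delta -> 0 < eps ->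
  exists n0 : nat, forall n, (n0 <= n)%N -> forall Q, PP Q ->
    (Q [set x | (delta <= dM (empirical R n x) (marginal Q 0%N))%R] <= eps%:E)%E.
Proof.
move=> ugc delta0 eps0.
have /ugc/(_ _ (@open_ereal_lt' _ 0%E eps%:E _))[|n0 _ hn0] := delta0.
  by rewrite lte_fin.
exists n0 => n n0n Q PPQ; apply: (le_trans _ (ltW (hn0 n n0n))).
by apply: ereal_sup_ubound; exists Q.
Qed.

Theorem theorem2p4 (R : realType) (disp : measure_display)
  (E : measurableType disp)
  (PP : set (probability (Omega E) R))
  (PP_marginals : forall P : probability (Omega E) R, PP P ->
    forall i : nat, measure_eq (marginal P i) (marginal P 0%N))
  (M : set (probability E R))
  (M_marginals : forall P : probability (Omega E) R, PP P -> M (marginal P 0%N))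
  (M_empirical : forall (n : nat) (x : Omega E), M (empirical R n x))
  (dM : probability E R -> probability E R -> R)
  (dM_metric : metric_on M dM)
  (dM_measurable : forall (n : nat) (P : probability (Omega E) R), PP P ->
    measurable_fun [set: Omega E]
      (fun x => dM (empirical R n x) (marginal P 0%N)))
  (TT : completeMetricType R)
  (TT_separable : separable TT)
  (T : probability E R -> TT)
  (T_mapping : mapping_on M T)
  (That : nat -> {mfun Omega E >-> borel TT})
  (ThatE : forall (n : nat) (x : Omega E), That n x = T (empirical R n x))
  (PP_UGC : UGC PP dM)
  (P : probability (Omega E) R)
  (PP_P : PP P)
  (T_continuous : continuous_on_at M dM T (marginal P 0%N)) :
  marginally_robust_at PP dM (@prohorov R TT) That P.
Proof.
have [_ _ dMC dMtri] := dM_metric.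
move=> eps eps0; have eps20 : 0 < eps / 2 by rewrite divr_gt0.
have [eta eta0 Teta] := T_continuous _ eps20.
(* One half of [eta] bounds the distance from the empirical measure to [Q_1], the other the distance
   from [Q_1] to [P_1]. *)
have delta0 : 0 < eta / 2 by rewrite divr_gt0.
exists (eta / 2) => //.
have [n0 hn0] := UGC_uniform _ _ _ _ _ _ _ PP_UGC delta0 eps0.
exists n0 => Q PPQ PQ n n0n.
(* The closed ball of radius [eps / 2] around [T(P_1)]; as a thickening it is already known to be
   measurable. *)
pose B : set (borel TT) := thickening (eps / 2) [set T (marginal P 0%N)].
have mB : measurable B by exact: measurable_thickening.
(* Stated for a general [Q'], to be used for both [P] and [Q]. *)
have concentrated Q' : PP Q' ->
    dM (marginal P 0%N) (marginal Q' 0%N) <= eta / 2 ->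
    (distribution Q' (That n) (~` B) <= eps%:E)%E.
  move=> PPQ' PQ'; apply: (le_trans _ (hn0 n n0n Q' PPQ')).
  have mTB : measurable (That n @^-1` (~` B)).
    by rewrite -[X in measurable X]setTI; apply: measurable_funPT => //;
      exact: measurableC.
  have mD : measurable
      [set x | eta / 2 <= dM (empirical R n x) (marginal Q' 0%N)].
    rewrite -[X in measurable X]setTI -preimage_itvcy.
    exact: dM_measurable.
  apply: (@le_measure _ _ _ Q' (That n @^-1` (~` B))); rewrite ?inE//.
  (* By contraposition: an empirical measure within [eta / 2] of [Q'_1] is within [eta] of [P_1], so
     continuity sends it into [B]. *)
  move=> x /= nBx; rewrite leNgt; apply/negP => near_Q'.
  apply: nBx; apply/thickening_set1; rewrite ThatE.
  apply/ltW/Teta; first exact: M_empirical.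
  apply: (le_lt_trans (dMtri _ (marginal Q' 0%N) _ _ _ _)); do ?by auto.
  by rewrite [eta]splitr ltr_leD// dMC//; auto.
apply: (prohorov_le_concentrated _ _ _ _ _ B) => //.
- move=> s t /thickening_set1 sB /thickening_set1 tB.
  apply: (le_trans (metric_triangle s (T (marginal P 0%N)) t)).
  by rewrite [eps]splitr lerD// metric_sym.
(* For [P] itself the distance between the marginals is zero. *)
- apply: concentrated => //; have [_ dM0 _ _] := dM_metric.
  have -> : dM (marginal P 0%N) (marginal P 0%N) = 0 by apply/dM0; auto.
  exact: ltW.
- exact: concentrated.
Qed.
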